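(* Let $B$ be a maximal lattice-free polyhedron in $\mathbb{R}^n$ with $f\in \operatorname{int}(B)$. Then the function $\phi_{B-f}^\ast:\mathbb{R}^n\to\mathbb{R}$ defined by $\phi_{B-f}^\ast(r) := \inf_{w \in \mathbb{Z}^n} \phi_{B-f}(r+w)$ is a minimal lifting for the gauge function $\phi_{B-f}$ of $B-f$ if and only if $\phi_{B-f}$ has a unique minimal lifting.
   Context: A set $B\subseteq\mathbb{R}^n$ is lattice-free if it is $n$-dimensional, closed, convex and $\operatorname{int}(B)\cap\mathbb{Z}^n=\emptyset$; it is maximal lattice-free if it is inclusion-maximal among lattice-free sets. For $f\in\operatorname{int}(B)$, the gauge function of $B-f$ is $\phi_{B-f}(r)=\inf\{\rho>0: r/\rho\in B-f\}$. For $f\in\mathbb{R}^n\setminus\mathbb{Z}^n$, a cut-generating pair for $f$ is a pair of nonnegative functions $\psi,\pi:\mathbb{R}^n\to\mathbb{R}$ such that for all integers $k,\ell\ge 0$, not both zero, and all matrices $R\in\mathbb{R}^{n\times k}$ with columns $r_1,\dots,r_k$ and $P\in\mathbb{R}^{n\times \ell}$ with columns $p_1,\dots,p_\ell$, the inequality $\sum_{i=1}^k\psi(r_i)s_i+\sum_{j=1}^\ell\pi(p_j)y_j\ge 1$ holds for every $(s,y)\in\mathbb{R}_+^k\times\mathbb{Z}_+^\ell$ with $f+Rs+Py\in\mathbb{Z}^n$. In this case $\pi$ is called a lifting of $\psi$. A lifting $\pi'$ of $\psi$ dominates a lifting $\pi''$ if $\pi'(r)\le\pi''(r)$ for all $r\in\mathbb{R}^n$;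 a minimal lifting is a lifting not dominated by another, distinct lifting. *)

(* Defs.v *)
(* R^n is encoded as column vectors over an arbitrary real field of type
   [realType], with the product topology. *)
From HB Require Import structures.
From mathcomp Require Import all_boot all_order all_algebra.
From mathcomp Require Import all_classical all_reals all_analysis.

Set Implicit Arguments.
Unset Strict Implicit.
Unset Printing Implicit Defensive.

Import Order.TTheory GRing.Theory Num.Theory.
Import numFieldNormedType.Exports.

Local Open Scope classical_set_scope.
Local Open Scope ring_scope.

Definition int_lattice (R : realType) (n : nat) : set 'cV[R]_n :=
  [set x | forall i, x i ord0 \is a Num.int].
Arguments int_lattice {R n}.

Definition affinely_independent (R : realType) (n k : nat)
    (p : 'I_k -> 'cV[R]_n) : Prop :=
  forall c : 'I_k -> R,
    \sum_(i < k) c i = 0 -> \sum_(i < k) c i *: p i = 0 -> forall i, c i = 0.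

(* [n]-dimensional means that the affine hull of [B] has dimension [n], i.e.,
   that [B] contains [n + 1] affinely independent points. *)
Definition full_dimensional (R : realType) (n : nat) (B : set 'cV[R]_n) :
    Prop :=
  exists p : 'I_n.+1 -> 'cV[R]_n,
    affinely_independent p /\ forall i, B (p i).

Definition lattice_free (R : realType) (n : nat) (B : set 'cV[R]_n) : Prop :=
  [/\ full_dimensional B, closed B, @convex_set R 'cV[R]_n B
    & interior B `&` int_lattice = set0].

Definition maximal_lattice_free (R : realType) (n : nat) (B : set 'cV[R]_n) :
    Prop :=
  lattice_free B /\
  forall C : set 'cV[R]_n, lattice_free C -> B `<=` C -> B = C.

Definition polyhedron (R : realType) (n : nat) (B : set 'cV[R]_n) : Prop :=
  exists (m : nat) (A : 'M[R]_(m, n)) (b : 'cV[R]_m),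
    B = [set x | forall i, (A *m x) i ord0 <= b i ord0].

(* [inf] is the real-valued infimum, with junk value 0 on sets that are empty
   or not bounded below. The set below is bounded below by 0, and it is
   nonempty for every [r] whenever 0 is in the interior of [C]. *)
Definition gauge_function (R : realType) (n : nat) (C : set 'cV[R]_n)
    (r : 'cV[R]_n) : R :=
  inf [set rho : R | 0 < rho /\ C (rho^-1 *: r)].

Definition cut_generating_pair (R : realType) (n : nat) (f : 'cV[R]_n)
    (psi pi : 'cV[R]_n -> R) : Prop :=
  [/\ forall r, 0 <= psi r,
      forall r, 0 <= pi r
    & forall (k l : nat) (M : 'M[R]_(n, k)) (P : 'M[R]_(n, l)),
        (0 < k + l)%N ->
        forall (s : 'cV[R]_k) (y : 'cV[nat]_l),
          (forall i, 0 <= s i ord0) ->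
          int_lattice (f + M *m s + P *m map_mx (fun t : nat => t%:R) y) ->
          1 <= \sum_(i < k) psi (col i M) * s i ord0 +
               \sum_(j < l) pi (col j P) * (y j ord0)%:R].

Definition lifting (R : realType) (n : nat) (f : 'cV[R]_n)
    (psi pi : 'cV[R]_n -> R) : Prop :=
  cut_generating_pair f psi pi.

Definition dominates (R : realType) (n : nat) (pi1 pi2 : 'cV[R]_n -> R) :
    Prop :=
  forall r, pi1 r <= pi2 r.

Definition minimal_lifting (R : realType) (n : nat) (f : 'cV[R]_n)
    (psi pi : 'cV[R]_n -> R) : Prop :=
  lifting f psi pi /\
  ~ exists pi', [/\ lifting f psi pi', pi' <> pi & dominates pi' pi].

Definition lattice_inf (R : realType) (n : nat) (phi : 'cV[R]_n -> R)
    (r : 'cV[R]_n) : R :=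
  inf [set phi (r + w) | w in int_lattice].

(* Main.v *)
Require Import Defs.
From HB Require Import structures.
From mathcomp Require Import all_boot all_order all_algebra.
From mathcomp Require Import all_classical all_reals all_analysis.
From mathcomp Require Import ring lra.

Set Implicit Arguments.
Unset Strict Implicit.
Unset Printing Implicit Defensive.

Import Order.TTheory GRing.Theory Num.Theory.
Import numFieldNormedType.Exports.

Local Open Scope classical_set_scope.
Local Open Scope ring_scope.

(** Write [S = lattice_inf phi] and [L] for the integer lattice.  What matters
    about [phi] is that it is nonnegative, sublinear and at least 1 on [L - f];
    [gauge_lattice_gauge] extracts this from the convex set [B].

    Every minimal lifting [h] lies below [S], because an integer variable with
    column [p] can be replaced by a continuous variable with column [p + w] for
    any [w] in [L].  As [S] is itself a lifting, it is the only minimal lifting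
    as soon as it is minimal.

    Conversely, let [h] be the unique minimal lifting.  By Zorn's lemma it lies
    below every lifting.  Like every minimal lifting it is [L]-periodic,
    subadditive and symmetric, [h p + h (- f - p) = 1].  Suppose [h <> S]; then
    [S p + S q > 1] for some [p], with [q = - f - p].  Lowering the value of [S]
    at [p] alone to [l] leaves a lifting when [N * l + S (- f - N p) >= 1] for all
    [N >= 1], so for [l = h p] these inequalities cannot have uniform slack
    ([least_no_slack]).  If [S p] and [S q] are positive, the inequality
    [N = 1] is slack at [p] and at [q], which forces [h (2 p) = 2 * h p] and
    [h (2 q) = 2 * h q].  As [2 p] and [q - p] are symmetric to each other, and
    so are [2 q] and [p - q], this gives [h p = h q = 1 / 2]; then only [N = 2]
    can be tight, so [S (- f - 2 p) = 0] and, exchanging [p] and [q],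
    [S (f + 2 p) = 0] ([least_gap]).

    The hypotheses on [p] are open conditions, so the same holds at
    [p + f / 2k] for large [k].  Adding the two equations gives
    [S (- f / k) <= 0], hence [S (- f) <= 0], against [S (- f) >= 1].
    Positivity of [S p] can always be arranged: move [p] to a nearby point
    [(w - f) / k] with [w] in [L], where [k * S ((w - f) / k) >= S (w - f) >= 1]. *)

(** * Lattice points and gauges *)

Ltac entrywise_ring := apply/matrixP => ? ?; rewrite !mxE; ring.

Lemma int_latticeD (R : realType) (n : nat) (v w : 'cV[R]_n) :
  int_lattice v -> int_lattice w -> int_lattice (v + w).
Proof. by move=> Lv Lw i; rewrite mxE rpredD. Qed.

Lemma int_latticeN (R : realType) (n : nat) (v : 'cV[R]_n) :
  int_lattice v -> int_lattice (- v).
Proof. by move=> Lv i; rewrite mxE rpredN. Qed.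

Lemma int_lattice0 (R : realType) (n : nat) : @int_lattice R n 0.
Proof. by move=> i; rewrite mxE rpred0. Qed.

Lemma int_latticeZ (R : realType) (n N : nat) (v : 'cV[R]_n) :
  int_lattice v -> int_lattice (N%:R *: v).
Proof. by move=> Lv i; rewrite mxE rpredM // natr_int. Qed.

Lemma exists_natr_mul_gt (R : realType) (x y : R) : 0 <= x -> 0 < y ->
  exists2 k, (0 < k)%N & x < k%:R * y.
Proof.
move=> x0 y0; exists (Num.bound (x / y)).+1 => //.
rewrite -ltr_pdivrMr //; apply: lt_le_trans (archi_boundP _) _.
  by rewrite divr_ge0 // ltW.
by rewrite ler_nat.
Qed.

Record lattice_gauge (R : realType) (n : nat) (f : 'cV[R]_n)
    (phi : 'cV[R]_n -> R) : Prop := LatticeGauge {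
  gauge_ge0 : forall x, 0 <= phi x;
  gaugeD : forall x y, phi (x + y) <= phi x + phi y;
  gaugeZ : forall t x, 0 <= t -> phi (t *: x) = t * phi x;
  gauge_lattice : forall x, int_lattice (f + x) -> 1 <= phi x }.

(** For sublinear [phi] all continuous variables can be merged into a single
    vector [x], and integer multiplicities become repetitions in the list [ps];
    this removes matrices from the lifting condition. *)
Definition aggregated_lifting (R : realType) (n : nat) (f : 'cV[R]_n)
    (phi pi : 'cV[R]_n -> R) : Prop :=
  (forall r, 0 <= pi r) /\
  forall x (ps : seq 'cV[R]_n), int_lattice (f + x + \sum_(p <- ps) p) ->
    1 <= phi x + \sum_(p <- ps) pi p.

Section Gauge.
Context (R : realType) (n : nat) (f : 'cV[R]_n) (phi : 'cV[R]_n -> R).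
Hypothesis gphi : lattice_gauge f phi.

Lemma gauge0 : phi 0 = 0.
Proof. by rewrite -(scale0r (0 : 'cV[R]_n)) (gaugeZ gphi) // mul0r. Qed.

Lemma gauge_sum (I : Type) (s : seq I) (F : I -> 'cV[R]_n) :
  phi (\sum_(i <- s) F i) <= \sum_(i <- s) phi (F i).
Proof.
elim: s => [|i s IH]; first by rewrite !big_nil gauge0.
by rewrite !big_cons (le_trans (gaugeD gphi _ _)) // lerD2l.
Qed.

(** A list is a matrix with all multiplicities equal to 1; conversely sublinearity
    bounds [phi (M *m s)] by the weighted sum of the gauges of the columns. *)
Lemma lifting_aggregatedP (pi : 'cV[R]_n -> R) :
  lifting f phi pi <-> aggregated_lifting f phi pi.
Proof.
split=> [[_ pi0 valid]|[pi0 valid]].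
  split=> // x ps Lps.
  have := valid 1 (size ps) x (\matrix_(i, j) (ps`_j) i ord0) isT
    (const_mx 1) (const_mx 1).
  rewrite big_ord1 mxE mulr1.
  have -> : col ord0 x = x by apply/colP=> i; rewrite mxE.
  rewrite (big_nth 0) big_mkord => {}valid.
  apply: le_trans (valid _ _) _; first by move=> i; rewrite mxE.
    congr int_lattice: Lps; congr (_ + _ + _).
      by apply/colP=> i; rewrite mxE big_ord1 mxE mulr1.
    rewrite (big_nth 0) big_mkord; apply/colP=> i.
    by rewrite mxE summxE; apply: eq_bigr => j _; rewrite !mxE mulr1.
  rewrite lerD2l; apply: ler_sum => j _; rewrite mxE mulr1.
  by have -> : col j (\matrix_(i, j) (ps`_j) i ord0) = ps`_j
    by apply/colP=> i; rewrite !mxE.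
split=> // [x|k l M P _ s y s0 Ly]; first exact: (gauge_ge0 gphi).
pose ps := flatten [seq nseq (y j ord0) (col j P) | j <- enum 'I_l].
have sum_ps (W : lmodType R) (g : 'cV[R]_n -> W) :
    \sum_(p <- ps) g p = \sum_(j < l) (y j ord0)%:R *: g (col j P).
  rewrite big_flatten big_map big_enum /=; apply: eq_bigr => j _.
  by rewrite big_nseq -Monoid.iteropE scaler_nat.
have MsE : M *m s = \sum_(i < k) s i ord0 *: col i M.
  apply/colP=> i; rewrite mxE summxE; apply: eq_bigr => j _.
  by rewrite !mxE mulrC.
have PyE : P *m map_mx (fun t : nat => t%:R) y = \sum_(p <- ps) p.
  rewrite (sum_ps _ id); apply/colP=> i; rewrite mxE summxE.
  by apply: eq_bigr => j _; rewrite !mxE mulrC.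
rewrite PyE in Ly; apply: le_trans (valid _ _ Ly) _.
apply: lerD.
  rewrite MsE; apply: le_trans (gauge_sum _ _) _; apply: ler_sum => i _.
  by rewrite (gaugeZ gphi) // mulrC.
rewrite (sum_ps R^o pi); apply: ler_sum => j _.
by rewrite mulrC.
Qed.

(** * Changing a lifting at one point *)

Lemma sum_count_mem (W : nmodType) (g : 'cV[R]_n -> W) r ps :
  \sum_(p <- ps) g p =
  g r *+ count_mem r ps + \sum_(p <- seq.filter (predC1 r) ps) g p.
Proof.
rewrite (bigID (pred1 r)) /= big_filter; congr (_ + _).
elim: ps => [|p ps IH]; first by rewrite big_nil.
by rewrite big_cons /= IH; case: eqP => [->|_]; rewrite ?mulrS ?add0n.
Qed.

Lemma sum_nseq (W : lmodType R) (g : 'cV[R]_n -> W) N r :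
  \sum_(p <- nseq N r) g p = N%:R *: g r.
Proof. by rewrite big_nseq -Monoid.iteropE scaler_nat. Qed.

Lemma sum_nseqR (g : 'cV[R]_n -> R) N r :
  \sum_(p <- nseq N r) g p = N%:R * g r.
Proof. exact: (sum_nseq (W := R^o)). Qed.

Definition update (pi : 'cV[R]_n -> R) r (l : R) : 'cV[R]_n -> R :=
  fun x => if x == r then l else pi x.

Lemma lifting_update (pi : 'cV[R]_n -> R) r l :
  aggregated_lifting f phi pi -> 0 <= l ->
  (forall N x ps, (0 < N)%N ->
     int_lattice (f + x + N%:R *: r + \sum_(p <- ps) p) ->
     1 <= phi x + N%:R * l + \sum_(p <- ps) pi p) ->
  aggregated_lifting f phi (update pi r l).
Proof.
move=> [pi0 valid] l0 validr; split=> [x|x ps]; first by rewrite /update; case: ifP.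
rewrite (sum_count_mem id r) (sum_count_mem (update pi r l) r).
rewrite (eq_big_seq (F1 := update pi r l) pi); last first.
  by move=> p; rewrite mem_filter /update /= => /andP[/negPf ->].
rewrite /update eqxx -scaler_nat -[l *+ _]mulr_natl.
case: (posnP (count_mem r ps)) => [->|c0]; last by rewrite !addrA; exact: validr.
by rewrite scale0r mul0r !add0r; exact: valid.
Qed.

(** The tool behind every property of minimal liftings: a coefficient [l] that
    keeps all inequalities in which [r] occurs valid could replace [pi r], so
    minimality leaves no room below [pi r]. *)
Lemma minimal_lifting_le pi r l :
  minimal_lifting f phi pi -> 0 <= l ->
  (forall N x ps, (0 < N)%N ->
     int_lattice (f + x + N%:R *: r + \sum_(p <- ps) p) ->
     1 <= phi x + N%:R * l + \sum_(p <- ps) pi p) ->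
  pi r <= l.
Proof.
move=> [lpi minpi] l0 validr; rewrite leNgt; apply/negP => lr; apply: minpi.
exists (update pi r l); split.
- apply/(lifting_aggregatedP); apply: lifting_update => //.
  exact/lifting_aggregatedP.
- by move=> /(congr1 (@^~ r)); rewrite /update eqxx => e; rewrite e ltxx in lr.
- by move=> x; rewrite /update; case: eqP => // ->; exact: ltW.
Qed.

(** * The lattice infimum of the gauge *)

Local Notation S := (lattice_inf phi).

Lemma lattice_inf_le w r : int_lattice w -> S r <= phi (r + w).
Proof.
move=> Lw; apply: ge_inf; last by exists w.
by exists 0 => _ [v _ <-]; exact: (gauge_ge0 gphi).
Qed.

Lemma le_lattice_inf c r :
  (forall w, int_lattice w -> c <= phi (r + w)) -> c <= S r.
Proof.
move=> H; apply: lb_le_inf; first by exists (phi (r + 0)), 0 => //; exact: int_lattice0.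
by move=> _ [w Lw <-]; exact: H.
Qed.

Lemma lattice_inf_ge0 r : 0 <= S r.
Proof. by apply: le_lattice_inf => w _; exact: (gauge_ge0 gphi). Qed.

Lemma lattice_inf_le_gauge r : S r <= phi r.
Proof. by rewrite -[X in phi X]addr0; apply/lattice_inf_le/int_lattice0. Qed.

Lemma lattice_inf_periodic w r : int_lattice w -> S (r + w) <= S r.
Proof.
move=> Lw; apply: le_lattice_inf => v Lv.
have -> : r + v = r + w + (v - w) by entrywise_ring.
by apply: lattice_inf_le; apply: int_latticeD => //; exact: int_latticeN.
Qed.

Lemma lattice_infD x y : S (x + y) <= S x + S y.
Proof.
rewrite -lerBlDr; apply: le_lattice_inf => w Lw.
rewrite lerBlDr -lerBlDl; apply: le_lattice_inf => v Lv.
rewrite lerBlDl; apply: le_trans (gaugeD gphi _ _).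
have -> : x + w + (y + v) = x + y + (w + v) by entrywise_ring.
exact/lattice_inf_le/int_latticeD.
Qed.

Lemma lattice_inf_sum ps : S (\sum_(p <- ps) p) <= \sum_(p <- ps) S p.
Proof.
elim: ps => [|p ps IH].
  by rewrite !big_nil -[leRHS]gauge0 lattice_inf_le_gauge.
by rewrite !big_cons (le_trans (lattice_infD _ _)) // lerD2l.
Qed.

Lemma lattice_infZ N x : S (N%:R *: x) <= N%:R * S x.
Proof.
have := lattice_inf_sum (nseq N x).
by rewrite (sum_nseq id) sum_nseqR.
Qed.

Lemma lattice_inf_ge1 x : int_lattice (f + x) -> 1 <= S x.
Proof.
move=> Lx; apply: le_lattice_inf => w Lw; apply: (gauge_lattice gphi).
by rewrite addrA; exact: int_latticeD.
Qed.

(** [S] is subadditive, lies below [phi], and is at least 1 on [L - f]. *)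
Lemma lattice_inf_lifting : aggregated_lifting f phi S.
Proof.
split=> [|x ps Lps]; first exact: lattice_inf_ge0.
rewrite -addrA in Lps; apply: le_trans (lattice_inf_ge1 Lps) _.
apply: le_trans (lattice_infD _ _) _.
by apply: lerD (lattice_inf_le_gauge _) (lattice_inf_sum _).
Qed.

(** * Properties of minimal liftings *)

Section Minimal.
Context (h : 'cV[R]_n -> R).
Hypothesis minh : minimal_lifting f phi h.

Let alh : aggregated_lifting f phi h.
Proof. by apply/lifting_aggregatedP; case: minh. Qed.

Let h0 r : 0 <= h r. Proof. by case: alh. Qed.

(** An integer variable with column [r] can be traded for a continuous one with
    column [r + w]: the total changes by a multiple of the lattice vector [w]. *)
Lemma minimal_le_gauge w r : int_lattice w -> h r <= phi (r + w).
Proof.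
move=> Lw; apply: (minimal_lifting_le minh (gauge_ge0 gphi _)) => N x ps N0 Lps.
have [_ /(_ (x + N%:R *: (r + w)) ps) valid] := alh.
apply: le_trans (valid _) _.
  have -> : f + (x + N%:R *: (r + w)) + \sum_(p <- ps) p =
    f + x + N%:R *: r + \sum_(p <- ps) p + N%:R *: w.
    by move: (\sum_(p <- ps) p) => z; entrywise_ring.
  by apply: int_latticeD => //; exact: int_latticeZ.
rewrite lerD2r (le_trans (gaugeD gphi _ _)) // (gaugeZ gphi) //.
Qed.

Lemma minimal_le_lattice_inf r : h r <= S r.
Proof. by apply: le_lattice_inf => w; exact: minimal_le_gauge. Qed.

Lemma minimal_periodic w r : int_lattice w -> h (r + w) <= h r.
Proof.
move=> Lw; apply: (minimal_lifting_le minh (h0 _)) => N x ps N0 Lps.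
have [_ /(_ x (nseq N r ++ ps)) valid] := alh.
rewrite !big_cat /= (sum_nseq id) sum_nseqR in valid.
rewrite -addrA; apply: valid.
have -> : f + x + (N%:R *: r + \sum_(p <- ps) p) =
    f + x + N%:R *: (r + w) + \sum_(p <- ps) p - N%:R *: w.
  by move: (\sum_(p <- ps) p) => z; entrywise_ring.
by apply: int_latticeD => //; apply: int_latticeN; exact: int_latticeZ.
Qed.

Lemma minimalD a b : h (a + b) <= h a + h b.
Proof.
apply: (minimal_lifting_le minh); first by rewrite addr_ge0.
move=> N x ps N0 Lps.
have [_ /(_ x (nseq N a ++ nseq N b ++ ps)) valid] := alh.
rewrite !big_cat /= !(sum_nseq id) !sum_nseqR in valid.
rewrite mulrDr -!addrA; apply: valid.
by rewrite scalerDr -!addrA in Lps *.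
Qed.

Lemma minimal_sum ps : h (\sum_(p <- ps) p) <= \sum_(p <- ps) h p.
Proof.
elim: ps => [|p ps IH].
  rewrite !big_nil -[leRHS]gauge0.
  exact: le_trans (minimal_le_lattice_inf _) (lattice_inf_le_gauge _).
by rewrite !big_cons (le_trans (minimalD _ _)) // lerD2l.
Qed.

Lemma minimalZ N x : h (N%:R *: x) <= N%:R * h x.
Proof.
have := minimal_sum (nseq N x).
by rewrite (sum_nseq id) sum_nseqR.
Qed.

Lemma minimal_reflect_ge1 r : 1 <= h r + h (- f - r).
Proof.
have [_ /(_ 0 [:: r; - f - r])] := alh.
rewrite !big_cons !big_nil !addr0 gauge0 add0r; apply.
have -> : f + (r + (- f - r)) = 0 by entrywise_ring.
exact: int_lattice0.
Qed.

(** If the sum were [d > 1], periodicity and subadditivity would give every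
    solution in which [r] occurs a total of at least [d], so the coefficient of
    [r] could be divided by [d].  This is a strict decrease only when [h r > 0];
    otherwise [h (- f - r) > 0] and the roles are exchanged. *)
Lemma minimal_reflect r : h r + h (- f - r) = 1.
Proof.
apply/eqP; rewrite eq_le minimal_reflect_ge1 andbT leNgt; apply/negP.
wlog hr : r / 0 < h r => [main|sum1].
  move=> sum1; have [hr|] := ltP 0 (h r); first exact: (main r).
  move=> hr; apply: (main (- f - r)); first by move: sum1 hr (h0 r); lra.
  by have -> : - f - (- f - r) = r by [entrywise_ring]; rewrite addrC.
set d := h r + h (- f - r) in sum1.
suff : h r <= h r / d.
  by rewrite ler_pdivlMr ?(lt_trans ltr01) //; move: hr sum1; nra.
have d0 : 0 < d by rewrite (lt_trans ltr01).
apply: (minimal_lifting_le minh); first by rewrite divr_ge0 // ltW.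
case=> // N x ps _ Lps.
have tot : d <= phi x + N.+1%:R * h r + \sum_(p <- ps) h p.
  set z := \sum_(p <- ps) p in Lps.
  have hz : h z <= \sum_(p <- ps) h p by exact: minimal_sum.
  have hx : h x <= phi x.
    exact: le_trans (minimal_le_lattice_inf _) (lattice_inf_le_gauge _).
  have refl : h (- f - r) <= h (x + N%:R *: r + z).
    have -> : - f - r = x + N%:R *: r + z - (f + x + N.+1%:R *: r + z).
      by rewrite -natr1; entrywise_ring.
    exact/minimal_periodic/int_latticeN.
  have := minimalD (x + N%:R *: r) z; have := minimalD x (N%:R *: r).
  have := minimalZ N r; rewrite -natr1 mulrDl mul1r /d.
  by move: refl hz hx; lra.
apply: (@le_trans _ _ ((phi x + N.+1%:R * h r + \sum_(p <- ps) h p) / d)).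
  by rewrite ler_pdivlMr // mul1r.
rewrite !mulrDl -mulrA.
have shrink t : 0 <= t -> t / d <= t.
  by move=> t0; rewrite ler_pdivrMr // ler_peMr // ltW.
apply: lerD; first by rewrite lerD2r shrink // (gauge_ge0 gphi).
by rewrite shrink // sumr_ge0.
Qed.

End Minimal.

(** * Minimal liftings below a given lifting *)

(** A lifting inequality involves finitely many values, so along a chain one
    member approximates the infimum at all of them. *)
Lemma aggregated_chain_inf (A : set ('cV[R]_n -> R)) :
  A !=set0 -> (forall pi, A pi -> aggregated_lifting f phi pi) ->
  total_on A (@dominates R n) ->
  aggregated_lifting f phi (fun r => inf [set pi r | pi in A]).
Proof.
move=> [pi1 Api1] lA totA; set m := fun r => _.
have ne r : [set pi r | pi in A] !=set0 by exists (pi1 r), pi1.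
have lb r : lbound [set pi r | pi in A] 0.
  by move=> _ [pi Api <-]; case: (lA _ Api).
split=> [r|x ps Lps]; first exact: lb_le_inf.
have approx e : 0 < e -> exists2 pi, A pi &
    \sum_(p <- ps) pi p <= \sum_(p <- ps) m p + (size ps)%:R * e.
  move=> e0; elim: {Lps}ps => [|p ps [pi Api IH]].
    by exists pi1 => //; rewrite !big_nil mul0r addr0.
  have [_ [pi' Api' <-] pi'p] : exists2 y, [set pi p | pi in A] y & y < m p + e.
    by apply: inf_adherent => //; split=> //; exists 0.
  have {}IH : pi p + \sum_(p <- ps) pi p <= pi p +
      (\sum_(p <- ps) m p + (size ps)%:R * e) by rewrite lerD2l.
  have [le|le] := totA _ _ Api Api'.
    exists pi => //; rewrite !big_cons /= -natr1; move: (le p) pi'p IH; lra.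
  exists pi' => //; rewrite !big_cons /= -natr1.
  have : \sum_(p <- ps) pi' p <= \sum_(p <- ps) pi p by exact: ler_sum.
  by move: pi'p IH; lra.
rewrite leNgt; apply/negP => lt1.
(* One share more than there are entries, so that the total error stays below
   the defect. *)
pose e := (1 - (phi x + \sum_(p <- ps) m p)) / (size ps).+1%:R.
have e0 : 0 < e by rewrite divr_gt0 // subr_gt0.
have eE : (size ps)%:R * e + e = 1 - (phi x + \sum_(p <- ps) m p).
  by rewrite -[X in _ + X]mul1r -mulrDl natr1 mulrC divfK.
have [pi Api pile] := approx e e0.
have [_ /(_ x ps Lps)] := lA _ Api.
by move: pile eE e0; lra.
Qed.

Lemma minimal_lifting_below pi0 :
  aggregated_lifting f phi pi0 ->
  exists2 h, minimal_lifting f phi h & dominates h pi0.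
Proof.
move=> lpi0.
pose P (g : 'cV[R]_n -> R) := aggregated_lifting f phi g /\ dominates g pi0.
pose T := {g | P g}.
pose below : rel T := fun s t => `[< dominates (sval t) (sval s) >].
have [||||t maxt] := @Zorn T below.
- by move=> s; apply/asboolP => r.
- move=> r s t /asboolP rs /asboolP st; apply/asboolP => x.
  exact: le_trans (st x) (rs x).
- move=> [s ps] [t pt] /asboolP /= st /asboolP /= ts; apply: eq_exist.
  by apply/funext => x; apply/eqP; rewrite eq_le st ts.
- move=> A totA; have [[s0 As0]|A0] := pselect (A !=set0); last first.
    have l0 : P pi0 by split.
    by exists (exist P _ l0) => s As; case: A0; exists s.
  pose A' := [set sval s | s in A].
  have lA' pi : A' pi -> aggregated_lifting f phi pi by move=> [s _ <-]; case: (svalP s).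
  have infle s r : A s -> inf [set pi r | pi in A'] <= sval s r.
    move=> As; apply: ge_inf.
      by exists 0 => _ [pi /lA'[pi0' _] <-].
    by exists (sval s) => //; exists s.
  have lm : P (fun r => inf [set pi r | pi in A']).
    split.
      apply: aggregated_chain_inf => //; first by exists (sval s0), s0.
      move=> _ _ [s As <-] [t At <-].
      by case: (totA s t As At) => /asboolP; [right|left].
    by move=> r; apply: le_trans (infle _ _ As0) _; case: (svalP s0).
  by exists (exist P _ lm) => s As; apply/asboolP => r /=; exact: infle.
case: t maxt => h [lh hpi0] maxt; exists h => //; split.
  exact/lifting_aggregatedP.
move=> [pi [/lifting_aggregatedP lpi neq dom]].
have lpi' : P pi.
  by split=> // r; exact: le_trans (dom r) (hpi0 r).
apply: neq; have := maxt (exist P _ lpi').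
by move=> /(_ _)/(congr1 sval) /= -> //; apply/asboolP.
Qed.

(** * When the least lifting exists it is the lattice infimum *)

Lemma lattice_inf_perturb x u : S x - phi (- u) <= S (x + u).
Proof.
have := lattice_infD (x + u) (- u); rewrite addrK.
by have := lattice_inf_le_gauge (- u); lra.
Qed.

(** Rounding down leaves a vector of the unit cube, where [phi] is bounded by
    sublinearity. *)
Lemma lattice_cocompact : exists2 C, 0 <= C & forall x,
  exists w, [/\ int_lattice w, phi (x - w) <= C & phi (w - x) <= C].
Proof.
have sum0 (F : 'I_n -> 'cV[R]_n) : 0 <= \sum_(i < n) phi (F i).
  by apply: sumr_ge0 => i _; exact: (gauge_ge0 gphi).
exists (\sum_(i < n) phi (delta_mx i ord0) +
        \sum_(i < n) phi (- delta_mx i ord0)); first exact: addr_ge0.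
move=> x; pose w : 'cV[R]_n := \col_i (Num.floor (x i ord0))%:~R.
have box (F : 'I_n -> 'cV[R]_n) (t : 'I_n -> R) : (forall i, 0 <= t i <= 1) ->
    phi (\sum_(i < n) t i *: F i) <= \sum_(i < n) phi (F i).
  move=> t01; apply: le_trans (gauge_sum _ _) _; apply: ler_sum => i _.
  have /andP[t0 t1] := t01 i.
  by rewrite (gaugeZ gphi) // ler_piMl // (gauge_ge0 gphi).
pose t i := x i ord0 - w i ord0.
have t01 i : 0 <= t i <= 1.
  rewrite /t mxE; have /andP[] := floor_itv (x i ord0).
  by rewrite intrD; lra.
have xwE : x - w = \sum_(i < n) t i *: delta_mx i ord0.
  rewrite [LHS]matrix_sum_delta; apply: eq_bigr => i _.
  by rewrite big_ord1 !mxE /t !mxE.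
exists w; split; first by move=> i; rewrite mxE intr_int.
- by rewrite xwE (le_trans (box _ _ t01)) // lerDl.
- have -> : w - x = \sum_(i < n) t i *: (- delta_mx i ord0).
    rewrite -opprB xwE -sumrN; apply: eq_bigr => i _.
    by rewrite scalerN.
  by rewrite (le_trans (box _ _ t01)) // lerDr.
Qed.

Section Least.
Context (h : 'cV[R]_n -> R).
Hypotheses (minh : minimal_lifting f phi h)
  (leasth : forall pi, aggregated_lifting f phi pi -> dominates h pi).

Let h0 r : 0 <= h r.
Proof. by case: minh => -[]. Qed.

Let h_le r : h r <= S r. Proof. exact: minimal_le_lattice_inf. Qed.

(** With slack [eta] in all inequalities, [S] stays a lifting when its value at
    [p] is lowered to slightly below [h p], although [h] lies below all liftings.
    For large [N] the multiplicity alone makes the inequality hold, so that only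
    the finitely many [N <= M] limit the decrease. *)
Lemma least_no_slack p eta : 0 < h p -> 0 < eta ->
  ~ (forall N, (0 < N)%N -> 1 + eta <= N%:R * h p + S (- f - N%:R *: p)).
Proof.
move=> hp eta0 slack.
have [M M1 Mhp] := exists_natr_mul_gt (ler0n R 2) hp.
have M0 : 0 < M%:R :> R by rewrite ltr0n.
(* The first bound costs at most [eta] when [N <= M]; the second keeps
   [N * (h p - g) >= 1] when [N > M]. *)
pose g := Num.min (eta / M%:R) (h p / 2).
have g0 : 0 < g by rewrite lt_min !divr_gt0.
have gl : g <= h p / 2 by rewrite ge_min lexx orbT.
have gM : M%:R * g <= eta by rewrite mulrC -ler_pdivlMr // ge_min lexx.
have l0 : 0 <= h p - g by lra.
suff /leasth /(_ p) : aggregated_lifting f phi (update S p (h p - g)).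
  by rewrite /update eqxx; lra.
apply: lifting_update => //; first exact: lattice_inf_lifting.
move=> N x ps N0 Lps; set z := \sum_(p <- ps) p in Lps.
have Sz : S z <= \sum_(p <- ps) S p by exact: lattice_inf_sum.
have Sx : S x <= phi x by exact: lattice_inf_le_gauge.
have Sxz : S (- f - N%:R *: p) <= S x + S z.
  apply: le_trans (lattice_infD _ _).
  have -> : - f - N%:R *: p = x + z - (f + x + N%:R *: p + z).
    by entrywise_ring.
  exact/lattice_inf_periodic/int_latticeN.
have [NM|MN] := leqP N M.
  have : N%:R * g <= M%:R * g by rewrite ler_pM2r // ler_nat.
  by move: (slack N N0) Sxz Sx Sz gM; rewrite mulrBr; lra.
have : M%:R * (h p - g) <= N%:R * (h p - g).
  by apply: ler_wpM2r => //; rewrite ler_nat ltnW.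
have : M%:R * (h p / 2) <= M%:R * (h p - g) by rewrite ler_pM2l //; lra.
have := lattice_inf_ge0 z; have := lattice_inf_ge0 x.
by move: Sz Sx Mhp; lra.
Qed.

(** If [h p = S p], subadditivity turns the slack of the inequality [N = 1] into
    the same slack for all [N]. *)
Lemma least_lt p : 1 < S p + S (- f - p) -> 0 < S p -> h p < S p.
Proof.
move=> sum1 Sp; rewrite lt_neqAle h_le andbT; apply/eqP => hS.
have hp : 0 < h p by rewrite hS.
have d0 : 0 < S p + S (- f - p) - 1 by rewrite subr_gt0.
apply: (least_no_slack hp d0) => -[//|N] _.
have := lattice_infD (- f - N.+1%:R *: p) (N%:R *: p).
have -> : - f - N.+1%:R *: p + N%:R *: p = - f - p.
  by rewrite -natr1; entrywise_ring.
by have := lattice_infZ N p; rewrite hS -natr1; lra.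
Qed.

(** By symmetry [1 - S (- f - N p) <= h (N p) <= (N - 2) * h p + h (2 p)], so a
    defect in [h (2 p) <= 2 * h p] yields slack for all [N >= 2]; the hypothesis
    is slack for [N = 1]. *)
Lemma least_double p : h (- f - p) < S (- f - p) -> h (p + p) = h p + h p.
Proof.
move=> ltq; apply/eqP; rewrite eq_le minimalD //= leNgt; apply/negP => lt2.
have hp : 0 < h p by have := h0 (p + p); lra.
have refl := minimal_reflect minh p.
pose eta := Num.min (h p + h p - h (p + p)) (S (- f - p) - h (- f - p)).
have eta0 : 0 < eta by rewrite lt_min !subr_gt0 lt2.
apply: (least_no_slack hp eta0) => -[//|[_|N _]].
  by rewrite mul1r scale1r -refl -addrA lerD2l -lerBrDl ge_min lexx orbT.
have etal : eta <= h p + h p - h (p + p) by rewrite ge_min lexx.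
have split2 : N.+2%:R *: p = N%:R *: p + (p + p).
  by rewrite -!natr1; entrywise_ring.
have := minimal_reflect minh (N.+2%:R *: p).
have := minimalD minh (N%:R *: p) (p + p); rewrite -split2.
have := minimalZ minh N p; have := h_le (- f - N.+2%:R *: p).
rewrite -!natr1; move: etal; lra.
Qed.

(** Doubling at [p] and at [q = - f - p], symmetry and nonnegativity of [h] at
    [- f - 2 p] and [- f - 2 q] force [h p = 1 / 2].  The inequalities [N = 1] and
    [N >= 3] are then slack, so [N = 2] must be tight. *)
Lemma least_gap p : 1 < S p + S (- f - p) -> 0 < S p -> 0 < S (- f - p) ->
  S (- f - (p + p)) = 0.
Proof.
move=> sum1 Sp Sq; set q := - f - p in sum1 Sq *.
have qK : - f - q = p by rewrite /q; entrywise_ring.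
have ltp := least_lt sum1 Sp.
have ltq : h q < S q by apply: least_lt; rewrite ?qK // addrC.
have p2 : h (p + p) = h p + h p by exact: least_double.
have q2 : h (q + q) = h q + h q by apply: least_double; rewrite qK.
have reflp : h p + h q = 1 by exact: minimal_reflect.
have := minimal_reflect minh (p + p); have := minimal_reflect minh (q + q).
have := h0 (- f - (p + p)); have := h0 (- f - (q + q)).
move=> hq2 hp2 reflq2 reflp2.
have hp : h p = 1 / 2 by lra.
apply/eqP; rewrite eq_le lattice_inf_ge0 andbT leNgt; apply/negP => c0.
pose eta := Num.min (S q - 1 / 2) (Num.min (S (- f - (p + p))) (1 / 2)).
have eta0 : 0 < eta by rewrite !lt_min c0 /=; apply/andP; split; lra.
have hp0 : 0 < h p by lra.
apply: (least_no_slack hp0 eta0) => -[//|[_|[_|N _]]].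
- have : eta <= S q - 1 / 2 by rewrite ge_min lexx.
  by rewrite scale1r mul1r; lra.
- have : eta <= S (- f - (p + p)) by rewrite !ge_min lexx orbT.
  have -> : 2%:R *: p = p + p by rewrite scaler_nat mulr2n.
  by lra.
- have : eta <= 1 / 2 by rewrite !ge_min lexx !orbT.
  have := lattice_inf_ge0 (- f - N.+3%:R *: p).
  have : 0 <= N%:R * h p by rewrite mulr_ge0.
  have -> : N.+3%:R = N%:R + 3 :> R by rewrite -addn3 natrD.
  by rewrite mulrDl; lra.
Qed.

(** [least_gap] at [- f - p] and at [p + c f] gives zeros [f + 2 p] and
    [- f - 2 p - 2 c f] of [S], hence the zero [- 2 c f]; with [c = 1 / 2k],
    its multiple by [k] is [- f]. *)
Lemma least_no_interior_gap p :
  1 < S p + S (- f - p) -> 0 < S p -> 0 < S (- f - p) -> False.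
Proof.
move=> sum1 Sp Sq; set q := - f - p in sum1 Sq.
have phi0 := gauge_ge0 gphi.
pose D := phi f + phi (- f).
have D0 : 0 <= D by rewrite addr_ge0.
pose m := Num.min (S p + S q - 1) (Num.min (S p) (S q)).
have m0 : 0 < m by rewrite !lt_min subr_gt0 sum1 Sp.
have ms : m <= S p + S q - 1 by rewrite ge_min lexx.
have mp : m <= S p by rewrite !ge_min lexx orbT.
have mq : m <= S q by rewrite !ge_min lexx !orbT.
have [k k1 Dk] := exists_natr_mul_gt D0 m0.
have k0 : 0 < k%:R :> R by rewrite ltr0n.
pose c : R := (2 * k%:R)^-1.
have c0 : 0 < c by rewrite invr_gt0 mulr_gt0.
have cD : c * D < m / 2.
  have kc : k%:R * c = 1 / 2 by rewrite /c; field; rewrite gt_eqF.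
  have : c * D < c * (k%:R * m) by rewrite ltr_pM2l.
  by rewrite (mulrA c) (mulrC c k%:R) kc; lra.
have phiu : phi (c *: f) <= c * D.
  by rewrite (gaugeZ gphi) ?(ltW c0) // ler_pM2l // /D lerDl.
have phiNu : phi (- (c *: f)) <= c * D.
  by rewrite -scalerN (gaugeZ gphi) ?(ltW c0) // ler_pM2l // /D lerDr.
have := lattice_inf_perturb p (c *: f).
have := lattice_inf_perturb q (- (c *: f)); rewrite opprK.
set p2 := p + c *: f; have -> : q - c *: f = - f - p2 by rewrite /q /p2; entrywise_ring.
move=> Sq2 Sp2.
have gap2 : S (- f - (p2 + p2)) = 0 by apply: least_gap => //; lra.
have gap1 : S (f + (p + p)) = 0.
  have -> : f + (p + p) = - f - (q + q) by rewrite /q; entrywise_ring.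
  have qK : - f - q = p by rewrite /q; entrywise_ring.
  by apply: least_gap => //; rewrite ?qK // addrC.
have := lattice_infD (f + (p + p)) (- f - (p2 + p2)); rewrite gap1 gap2 addr0.
move=> Sfk.
have : S (k%:R *: (f + (p + p) + (- f - (p2 + p2)))) <= 0.
  by apply: le_trans (lattice_infZ _ _) _; rewrite mulr_ge0_le0 // ltW.
have -> : k%:R *: (f + (p + p) + (- f - (p2 + p2))) = - f.
  apply/matrixP => i j; rewrite !mxE /c; field; exact: lt0r_neq0.
rewrite leNgt => /negP; apply; apply: lt_le_trans ltr01 _.
by apply: lattice_inf_ge1; rewrite subrr; exact: int_lattice0.
Qed.

(** The point [p + u] below is [(w - f) / k]; it is close to [p] because [w] is a
    rounding of [f + k p], and [S] is positive there because [k] times it lies in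
    [L - f]. *)
Lemma least_no_gap p : 1 < S p + S (- f - p) -> 0 < S (- f - p) -> False.
Proof.
move=> sum1 Sq.
have [C C0 coc] := lattice_cocompact.
pose m := Num.min (S p + S (- f - p) - 1) (S (- f - p)).
have m0 : 0 < m by rewrite lt_min subr_gt0 sum1.
have ms : m <= S p + S (- f - p) - 1 by rewrite ge_min lexx.
have mq : m <= S (- f - p) by rewrite ge_min lexx orbT.
have [k k1 Ck2] := exists_natr_mul_gt (mulr_ge0 (ler0n _ 2) C0) m0.
have k0 : 0 < k%:R :> R by rewrite ltr0n.
have kV0 : 0 <= k%:R^-1 :> R by rewrite invr_ge0 ltW.
have Ck : k%:R^-1 * C < m / 2.
  by rewrite mulrC ltr_pdivrMr //; lra.
have [w [Lw phi1 phi2]] := coc (f + k%:R *: p).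
pose u := k%:R^-1 *: (w - (f + k%:R *: p)).
have phiu : phi u <= k%:R^-1 * C.
  by rewrite (gaugeZ gphi) // ler_wpM2l.
have phiNu : phi (- u) <= k%:R^-1 * C.
  by rewrite -scalerN opprB (gaugeZ gphi) // ler_wpM2l.
have := lattice_inf_perturb p u.
have := lattice_inf_perturb (- f - p) (- u); rewrite opprK.
have -> : - f - p - u = - f - (p + u) by entrywise_ring.
move=> Sq2 Sp2.
apply: (@least_no_interior_gap (p + u)); [lra| |lra].
have pos : 0 < k%:R * S (p + u).
  apply: lt_le_trans (lattice_infZ _ _); apply: lt_le_trans ltr01 _.
  apply: lattice_inf_ge1; congr int_lattice: Lw.
  apply/matrixP => i j; rewrite !mxE; field; exact: lt0r_neq0.
by rewrite pmulr_rgt0 in pos.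
Qed.

(** Symmetry turns a strict inequality [h p < S p] into
    [1 < S p + S (- f - p)]; at least one of the two terms is then positive. *)
Lemma least_eq_lattice_inf : h = S.
Proof.
apply/funext => p; apply/eqP; rewrite eq_le minimal_le_lattice_inf //= leNgt.
apply/negP => lt; have refl := minimal_reflect minh p.
have sum1 : 1 < S p + S (- f - p).
  by have := h_le (- f - p); lra.
have [Sq|Sq] := ltP 0 (S (- f - p)); first exact: least_no_gap Sq.
have qK : - f - (- f - p) = p by entrywise_ring.
by apply: (@least_no_gap (- f - p)); rewrite ?qK; lra.
Qed.

End Least.

Lemma lattice_inf_minimal_iff_unique :
  minimal_lifting f phi S <-> exists! pi, minimal_lifting f phi pi.
Proof.
split=> [minS|[h [minh uniqh]]].
  exists S; split=> // h minh; apply: contrapT => neq.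
  case: minS => _; apply; exists h; split; first by case: minh.
    by move=> e; exact: neq.
  exact: minimal_le_lattice_inf.
rewrite -(@least_eq_lattice_inf h) // => pi lpi.
by have [h' /uniqh -> //] := minimal_lifting_below lpi.
Qed.

End Gauge.

(** * Gauges of lattice-free convex sets *)

(** A lattice point [f + x] with [phi x < 1] would be a proper convex combination
    of a point of [B] and the interior point [f], hence interior to [B]. *)
Lemma gauge_lattice_gauge (R : realType) (n : nat) (B : set 'cV[R]_n)
    (f : 'cV[R]_n) :
  @convex_set R 'cV[R]_n B -> interior B `&` int_lattice = set0 ->
  interior B f -> lattice_gauge f (gauge_function [set x - f | x in B]).
Proof.
move=> convB freeB fB; set phi := gauge_function _.
have /nbhs_ballP[e /= e0 ballB] : nbhs f B := fB.
have conv a b t : B a -> B b -> 0 <= t -> t <= 1 -> B (t *: a + (1 - t) *: b).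
  move=> Ba Bb t0 t1; have := convB a b (Itv01 t0 t1).
  by rewrite !inE => /(_ Ba Bb).
have Bf : B f by apply: ballB; exact: ballxx.
pose G x : set R := [set rho | 0 < rho /\ B (f + rho^-1 *: x)].
have phiE x : phi x = inf (G x).
  congr inf; apply/seteqP; split=> rho /= [rho0].
    by case=> b Bb bE; split=> //; rewrite -bE addrC subrK.
  by move=> Brho; split=> //; exists (f + rho^-1 *: x) => //; rewrite addrC addKr.
have Gne x : G x !=set0.
  pose s := 1 + \sum_(i < n) `|x i ord0|.
  have s0 : 0 < s by rewrite ltr_pwDl // sumr_ge0.
  exists (s / e); split; first exact: divr_gt0.
  apply: ballB; split=> // i j; rewrite /ball /= (ord1 j) !mxE.
  rewrite opprD addrA subrr add0r normrN normrM gtr0_norm ?invr_gt0 ?divr_gt0 //.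
  rewrite invf_div mulrAC ltr_pdivrMr // ltr_pM2l //.
  rewrite /s (bigD1 i) //= addrCA ltrDl ltr_pwDl // sumr_ge0 //.
have Glb x : lbound (G x) 0 by move=> rho [/ltW].
have phi_le x rho : G x rho -> phi x <= rho.
  by move=> Grho; rewrite phiE; apply: ge_inf => //; exists 0.
have le_phi x c : (forall rho, G x rho -> c <= rho) -> c <= phi x.
  by move=> H; rewrite phiE; apply: lb_le_inf.
have phi0 x : 0 <= phi x by apply: (le_phi) => rho; exact: Glb.
have phiZ_le t x : 0 < t -> phi (t *: x) <= t * phi x.
  move=> t0; rewrite -ler_pdivrMl //; apply: (le_phi) => rho [rho0 Brho].
  rewrite ler_pdivrMl //; apply: phi_le; split; first exact: mulr_gt0.
  by rewrite scalerA invfM mulrAC mulVf ?gt_eqF // mul1r.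
split=> // [x y|t x|x Lx].
- rewrite -lerBlDr; apply: (le_phi) => a [a0 Ba].
  rewrite lerBlDr -lerBlDl; apply: (le_phi) => b [b0 Bb].
  rewrite lerBlDl; have ab0 : 0 < a + b by exact: addr_gt0.
  apply: phi_le; split=> //.
  have t0 : 0 <= a / (a + b) by rewrite divr_ge0 // ltW.
  have t1 : a / (a + b) <= 1 by rewrite ler_pdivrMr // mul1r lerDl ltW.
  congr B: (conv _ _ _ Ba Bb t0 t1); apply/matrixP => i j; rewrite !mxE.
  by field; rewrite !gt_eqF.
- rewrite le_eqVlt => /predU1P[<-|t0].
    rewrite scale0r mul0r; apply/eqP; rewrite eq_le phi0 andbT.
    apply/ler_addgt0Pr => rho rho0; rewrite add0r; apply: phi_le; split=> //.
    by rewrite scaler0 addr0.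
  apply/eqP; rewrite eq_le phiZ_le //= -ler_pdivlMl //.
  have tV0 : 0 < t^-1 by rewrite invr_gt0.
  have := phiZ_le _ (t *: x) tV0.
  by rewrite scalerA mulVf ?gt_eqF // scale1r.
apply: (le_phi) => rho [rho0 Brho]; rewrite leNgt; apply/negP => rho1.
have : (interior B `&` int_lattice) (f + x).
  split=> //; apply/nbhs_ballP; exists ((1 - rho) * e) => /=.
    by rewrite mulr_gt0 // subr_gt0.
  move=> y [_ yball].
  have r1 : 0 < 1 - rho by rewrite subr_gt0.
  pose z := f - (1 - rho)^-1 *: (f + x - y).
  have Bz : B z.
    apply: ballB; split=> // i j; have := yball i j; rewrite /ball /= !mxE.
    rewrite opprB addrCA subrr addr0 normrM gtr0_norm ?invr_gt0 //.
    by rewrite ltr_pdivrMl.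
  congr B: (conv _ _ _ Brho Bz (ltW rho0) (ltW rho1)).
  apply/matrixP => i j; rewrite !mxE; field.
  by rewrite !gt_eqF.
by rewrite freeB.
Qed.

Theorem proposition1p2 (R : realType) (n : nat) (B : set 'cV[R]_n)
    (f : 'cV[R]_n) (Bpoly : polyhedron B) (Bmax : maximal_lattice_free B)
    (fB : interior B f) :
  let phi := gauge_function [set x - f | x in B] in
  minimal_lifting f phi (lattice_inf phi) <->
  exists! pi : 'cV[R]_n -> R, minimal_lifting f phi pi.
Proof.
have [[_ _ convB freeB] _] := Bmax.
exact/lattice_inf_minimal_iff_unique/gauge_lattice_gauge.
Qed.
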